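(* Let $A_1,\dots,A_m\in\mathbb{R}^{n\times n}$, and for $A\in\mathbb{R}^{n\times n}$ let $M_A$ denote a matrix representation of the linear operator $X\mapsto AXA^T:\mathcal{S}\to\mathcal{S}$ on the space $\mathcal{S}$ of real symmetric $n\times n$ matrices. Then $$\frac{1}{\sqrt m}\,\rho\big(M_{A_1}+\cdots+M_{A_m}\big)^{1/2}\;\le\;\rho(A_1,\dots,A_m)\;\le\;\rho\big(M_{A_1}+\cdots+M_{A_m}\big)^{1/2}.$$
   Context: For a single real square matrix $A$, $\rho(A)=\lim_{k\to\infty}\|A^k\|^{1/k}$ is the spectral radius (the largest modulus of an eigenvalue). For a finite set of real $n\times n$ matrices the joint spectral radius is $$\rho(A_1,\dots,A_m)=\limsup_{k\to+\infty}\ \max_{\sigma\in\{1,\dots,m\}^k}\|A_\sigma\|^{1/k},\qquad A_\sigma=A_{\sigma_k}\cdots A_{\sigma_2}A_{\sigma_1},$$ where $\|\cdot\|$ is any matrix norm (the value does not depend on the choice). $\mathcal{S}$ is a real vector space of dimension $n(n+1)/2$; the matrix representations $M_{A_i}$ are all taken with respect to one and the same fixed basis of $\mathcal{S}$. *)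

(* Defs.v *)
From HB Require Import structures.
From mathcomp Require Import all_boot all_order all_algebra.
From mathcomp Require Import all_classical all_reals all_analysis.
Set Implicit Arguments.
Unset Strict Implicit.
Unset Printing Implicit Defensive.
Import Order.TTheory GRing.Theory Num.Theory numFieldNormedType.Exports.

Local Open Scope ring_scope.

(** Used on matrices, where "matrix norm" means any norm of the real vector space
    of matrices: submultiplicativity is not required. Nonnegativity follows. *)
Definition is_norm (R : realType) (V : lmodType R) (N : V -> R) : Prop :=
  [/\ forall X, N X = 0 -> X = 0,
      forall a X, N (a *: X) = `|a| * N X
    & forall X Y, N (X + Y) <= N X + N Y].

(** The term of index [0] in the sequences below is irrelevant to the limits
    (it equals [1], since [0%:R^-1 = 0]). *)
Definition spectral_radius (R : realType) (d : nat) (N : 'M[R]_d -> R)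
    (B : 'M[R]_d) : R :=
  limn (fun k : nat => N (B ^+ k) `^ k%:R^-1).

(** [A_(s_k) *m ... *m A_(s_1)]: the first letter acts first. *)
Definition word_prod (R : realType) (m n : nat) (A : 'I_m -> 'M[R]_n)
    (s : seq 'I_m) : 'M[R]_n :=
  \prod_(i <- rev s) A i.

(** The values [N _ `^ _] are nonnegative, so for [0 < m] the default [0] does
    not affect the maximum; the sequence is bounded, so that the real-valued
    [limn_sup] is the genuine limit superior. *)
Definition joint_spectral_radius (R : realType) (m n : nat) (N : 'M[R]_n -> R)
    (A : 'I_m -> 'M[R]_n) : R :=
  limn_sup (fun k : nat =>
    \big[Num.max/0]_(s : k.-tuple 'I_m) N (word_prod A s) `^ k%:R^-1).

Definition symmx (R : realType) (n : nat) : {vspace 'M[R]_n} :=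
  fixedSpace (linfun (@trmx R n n)).

(** [congr_fun A] is well defined as an operator on [symmx]: the projection
    [vsproj] is the identity on [A *m X *m A^T], see [congr_opE]. *)
Definition congr_fun (R : realType) (n : nat) (A : 'M[R]_n)
    (X : subvs_of (symmx R n)) : subvs_of (symmx R n) :=
  vsproj (symmx R n) (A *m vsval X *m A^T).

Definition congr_op (R : realType) (n : nat) (A : 'M[R]_n) :
    'End(subvs_of (symmx R n)) :=
  linfun (congr_fun A).

(** [passmx.mxof] represents operators on row vectors; the transpose gives the usual
    convention, in which column [j] holds the coordinates of the image of the
    [j]-th basis vector, see [congr_mxE]. *)
Definition congr_mx (R : realType) (n : nat)
    (e : (\dim {:subvs_of (symmx R n)}).-tuple (subvs_of (symmx R n)))
    (A : 'M[R]_n) : 'M[R]_(\dim {:subvs_of (symmx R n)}) :=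
  (passmx.mxof e e (congr_op A))^T.

Lemma symmxP (R : realType) (n : nat) (X : 'M[R]_n) :
  reflect (X^T = X) (X \in symmx R n).
Proof.
by apply: (iffP fixedSpaceP); rewrite lfunE.
Qed.

Lemma congr_fun_linear (R : realType) (n : nat) (A : 'M[R]_n) :
  linear (congr_fun A).
Proof.
move=> a u v.
rewrite /congr_fun -linearP; congr (vsproj _ _).
rewrite (linearP (vsval : subvs_of (symmx R n) -> _)) /=.
by rewrite mulmxDr mulmxDl -scalemxAr -scalemxAl.
Qed.

HB.instance Definition _ (R : realType) (n : nat) (A : 'M[R]_n) :=
  GRing.isSemilinear.Build R _ _ _ (congr_fun A)
    (GRing.semilinear_linear (congr_fun_linear A)).

Lemma congr_opE (R : realType) (n : nat) (A : 'M[R]_n)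
    (X : subvs_of (symmx R n)) :
  vsval (congr_op A X) = A *m vsval X *m A^T.
Proof.
rewrite lfunE /= /congr_fun vsprojK //; apply/symmxP.
by rewrite !trmx_mul trmxK mulmxA; have /symmxP -> := subvsP X.
Qed.

Lemma congr_mxE (R : realType) (n : nat)
    (e : (\dim {:subvs_of (symmx R n)}).-tuple (subvs_of (symmx R n)))
    (he : basis_of {:subvs_of (symmx R n)} e) (A : 'M[R]_n)
    (j : 'I_(\dim {:subvs_of (symmx R n)})) :
  congr_op A e`_j = \sum_i congr_mx e A i j *: e`_i.
Proof.
rewrite [LHS](coord_basis he) ?memvf //; apply: eq_bigr => i _.
by rewrite !mxE /= passmx.vecof_delta.
Qed.

(* Main.v *)
From HB Require Import structures.
Require Import Defs.
From mathcomp Require Import all_boot all_order all_algebra.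
From mathcomp Require Import all_classical all_reals all_analysis.
From mathcomp Require Import ring lra.
Set Implicit Arguments.
Unset Strict Implicit.
Unset Printing Implicit Defensive.
Import Order.TTheory GRing.Theory Num.Theory numFieldNormedType.Exports.
Local Open Scope ring_scope.

(** Write [L] for the operator [X |-> \sum_i A i *m X *m (A i)^T] on symmetric
    matrices and [M] for its matrix. Since [X |-> B *m X *m B^T] depends
    multiplicatively on [B], the power [L^k] is the sum of these operators over
    the products [A_s] with [s] a word of length [k]. Hence the trace of [L^k(I)]
    is the sum [S_k] of the squared Frobenius norms of the [A_s]
    ([frob2_sum]), and everything is read off from the growth of [S_k].

    The sequence [S_k] is submultiplicative, so by Fekete's lemma
    ([submul_root_cvg]) its [k]-th roots converge to some [r]. The trace of
    [L^k(I)] is a linear form in [M^k], and the matrix of [X |-> B *m X *m B^T]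
    is quadratic in [B]; this bounds any norm of [M^k] below and above by
    constant multiples of [S_k] ([norm_congr_mx_sum_exp_equiv]). Constants vanish
    under [k]-th roots, so [r] is the spectral radius of [M]; in particular the
    limit defining it exists.

    For the joint spectral radius, compare [S_k] with its largest term: up to
    constants, the square of the largest norm of a product of length [k] is at
    most [S_k] ([max_root_le_frob2_sum]) and at least [S_k / m^k]
    ([frob2_sum_le_max_root]). Taking [k]-th roots, the limit superior lies
    between the square roots of [r / m] and of [r]. That arbitrary norms are
    allowed rests on the equivalence of norms, obtained from the compactness of
    the unit sphere ([rV_norm_ge]). *)

(** * Equivalence of norms on matrices *)

Section norms.
Variable R : realType.

Lemma norm_coord_le m n (X : 'M[R]_(m, n)) i j : `|X i j| <= `|X|.
Proof.
rewrite [leRHS]/Num.norm /= mx_normrE.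
by apply/bigmax_geP; right => /=; exists (i, j).
Qed.

Lemma mx_norm_le m n (X : 'M[R]_(m, n)) c :
  0 <= c -> (forall i j, `|X i j| <= c) -> `|X| <= c.
Proof.
by move=> c0 Xc; rewrite [leLHS]/Num.norm /= mx_normrE; apply/bigmax_leP.
Qed.

Lemma norm_mxvec m n (X : 'M[R]_(m, n)) : `|mxvec X| = `|X|.
Proof.
apply/eqP; rewrite eq_le; apply/andP; split; apply: mx_norm_le => // i j.
  rewrite ord1; case/mxvec_indexP: j => a b.
  by rewrite mxvecE norm_coord_le.
by rewrite -mxvecE norm_coord_le.
Qed.

Lemma norm_mulmx_le m n p (X : 'M[R]_(m, n)) (Y : 'M[R]_(n, p)) :
  `|X *m Y| <= n%:R * (`|X| * `|Y|).
Proof.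
apply: mx_norm_le => [|i j]; first by rewrite !mulr_ge0.
rewrite mxE (le_trans (ler_norm_sum _ _ _))//.
rewrite -[n in n%:R]card_ord mulr_natl -sumr_const.
by apply: ler_sum => k _; rewrite normrM ler_pM ?norm_coord_le.
Qed.

Lemma norm_trmx m n (X : 'M[R]_(m, n)) : `|X^T| = `|X|.
Proof.
have le_tr p q (Y : 'M[R]_(p, q)) : `|Y^T| <= `|Y|.
  by apply: mx_norm_le => // i j; rewrite mxE norm_coord_le.
by apply/eqP; rewrite eq_le le_tr -[leLHS](congr1 Num.norm (trmxK X)) le_tr.
Qed.

(** Expanding [X] over the elementary matrices bounds [p X] by a combination of
    the entries of [X]. It is used for norms and for absolute values of linear
    forms alike. *)
Lemma seminorm_le m n (p : 'M[R]_(m, n) -> R) :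
  (forall a X, p (a *: X) = `|a| * p X) ->
  (forall X Y, p (X + Y) <= p X + p Y) ->
  exists2 C, 0 < C & forall X, p X <= C * `|X|.
Proof.
move=> pZ pD.
have p0 : p 0 = 0 by rewrite -(scale0r 0) pZ normr0 mul0r.
have p_ge0 X : 0 <= p X.
  have := pD X (- X); rewrite subrr p0 -scaleN1r pZ normrN1 mul1r; lra.
exists (1 + \sum_i \sum_j p (delta_mx i j)) => [|X].
  by rewrite ltr_pwDl// !sumr_ge0// => i _; rewrite sumr_ge0.
have psum (I : Type) (r : seq I) (F : I -> 'M[R]_(m, n)) :
    p (\sum_(i <- r) F i) <= \sum_(i <- r) p (F i).
  elim/big_rec2 : _ => [|i y1 y2 _ h]; first by rewrite p0.
  by rewrite (le_trans (pD _ _))// lerD2l.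
rewrite mulrDl mul1r mulr_suml [X in p X]matrix_sum_delta.
rewrite (le_trans (psum _ _ _))// ler_wpDl// ler_sum// => i _.
rewrite (le_trans (psum _ _ _))// mulr_suml ler_sum// => j _.
by rewrite pZ mulrC ler_wpM2l ?norm_coord_le.
Qed.

Lemma is_norm_ge0 (V : lmodType R) (N : V -> R) :
  is_norm N -> forall X, 0 <= N X.
Proof.
move=> [_ NZ ND] X; have := ND X (- X).
rewrite subrr -scaleN1r -{1}(scale0r X) !NZ normr0 normrN1; lra.
Qed.

(** A norm is continuous for the entrywise maximum norm, hence attains on the
    compact unit sphere a minimum, which is positive by definiteness. *)
Lemma rV_norm_ge n (N : 'rV[R]_n -> R) :
  is_norm N -> exists2 C, 0 < C & forall X, `|X| <= C * N X.
Proof.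
move=> hN; have N_ge0 := is_norm_ge0 hN.
have [N_eq0 NZ ND] := hN.
have [C C_gt0 NC] := seminorm_le NZ ND.
have Ncont : continuous N.
  move=> X; apply/(@cvgrPdist_le _ R^o _ _ (nbhs_filter X)) => e e_gt0.
  apply: filterS (nbhsx_ballx X _ (divr_gt0 e_gt0 C_gt0)) => Y.
  rewrite mx_norm_ball /ball_/= ltr_pdivlMr// mulrC => /ltW.
  move=> /(le_trans (NC _)); apply: le_trans.
  have := ND (X - Y) Y; have := ND (Y - X) X; rewrite !subrK.
  rewrite -(opprB X Y) -scaleN1r NZ normrN1 mul1r ler_norml => NXY NYX.
  by apply/andP; split; lra.
pose S := [set X : 'rV[R]_n | `|X| = 1]%classic.
have normM (X : 'rV[R]_n) : X != 0 -> S (`|X|^-1 *: X).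
  by move=> X0; rewrite /S /= normrZ normfV normr_id mulVf// normr_eq0.
(* The sphere is empty in dimension 0, where every vector is zero. *)
have [[X0 SX0]|S0] := pselect (S !=set0)%classic; last first.
  exists 1 => // X; suff -> : X = 0 by rewrite normr0 mul1r N_ge0.
  by apply/eqP/negPn/negP => /normM SX; apply: S0; exists (`|X|^-1 *: X).
have Scompact : compact S.
  apply: bounded_closed_compact.
    exists 1; split => // x x1 X SX; apply: le_trans (ltW x1).
    by rewrite le_eqVlt; apply/orP; left; apply/eqP; exact: SX.
  apply: (@closed_comp _ _ (fun X : 'rV[R]_n => `|X|) [set 1%R]%classic).
    by move=> X _; exact: norm_continuous.
  exact: closed_eq.
have [|Z ZS Zmin] := compact_EVT_min _ Scompact (continuous_subspaceT Ncont).
  by exists X0.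
have NZ_gt0 : 0 < N Z.
  rewrite lt_def N_ge0 andbT; apply/eqP => /N_eq0 Z0.
  by move: ZS; rewrite inE /S /= Z0 normr0 => /esym/eqP; rewrite oner_eq0.
exists (N Z)^-1 => [|X]; first by rewrite invr_gt0.
have [->|X_neq0] := eqVneq X 0; first by rewrite normr0 mulr_ge0// invr_ge0 ltW.
have : N Z <= N (`|X|^-1 *: X) by apply: Zmin; rewrite inE; exact: normM.
rewrite NZ normfV normr_id ler_pdivlMl ?normr_gt0//.
by rewrite ler_pdivlMl// mulrC.
Qed.

Lemma mx_norm_ge m n (N : 'M[R]_(m, n) -> R) :
  is_norm N -> exists2 C, 0 < C & forall X, `|X| <= C * N X.
Proof.
move=> [N0 NZ ND].
have [|C C0 NC] := @rV_norm_ge _ (N \o vec_mx).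
  split => [X /N0 /(canRL vec_mxK)|a X|X Y] /=.
  - by rewrite linear0.
  - by rewrite linearZ NZ.
  - by rewrite linearD ND.
by exists C => // X; have := NC (mxvec X); rewrite norm_mxvec /= mxvecK.
Qed.

End norms.

(** * Roots of sequences and limits superior *)

Section roots.
Local Open Scope classical_set_scope.
Variable R : realType.

Lemma cvg_root_cst (c : R) : 0 < c -> c `^ k%:R^-1 @[k --> \oo] --> (1 : R).
Proof.
move=> c0.
have inv0 : (k%:R : R)^-1 @[k --> \oo] --> (0 : R).
  apply/(gtr0_cvgV0 (f := fun k => k%:R : R)); last exact: cvgr_idn.
  by near=> k; rewrite ltr0n; near: k; exact: nbhs_infty_gt.
have -> : (fun k : nat => c `^ k%:R^-1) = (fun k => expR (k%:R^-1 * ln c)).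
  by apply/funext => k; rewrite /powR gt_eqF.
rewrite [X in _ --> X](_ : 1 = expR (0 * ln c)); last by rewrite mul0r expR0.
apply: continuous_cvg; first exact: continuous_expR.
by apply: cvgM; [exact: inv0|exact: cvg_cst].
Unshelve. all: by end_near. Qed.

(** The [k]-th root of a positive constant tends to 1, so a two-sided estimate up
    to constant factors does not change the limit of the [k]-th roots. *)
Lemma cvg_root_squeeze (u v : nat -> R) c C r : 0 < c -> 0 < C ->
  (forall k, 0 <= u k) ->
  (forall k, c * u k <= v k) -> (forall k, v k <= C * u k) ->
  u k `^ k%:R^-1 @[k --> \oo] --> (r : R) ->
  v k `^ k%:R^-1 @[k --> \oo] --> (r : R).
Proof.
move=> c0 C0 u0 cv vC ur.
have v0 k : 0 <= v k by apply: le_trans (cv k); rewrite mulr_ge0// ltW.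
have scale (a : R) : 0 < a -> a `^ k%:R^-1 * u k `^ k%:R^-1 @[k --> \oo] --> r.
  move=> a0; rewrite -[r in X in _ --> X]mul1r.
  by apply: cvgM; [exact: cvg_root_cst|exact: ur].
apply: (squeeze_cvgr _ (scale _ c0) (scale _ C0)).
apply: nearW => k; rewrite -!powRM ?(ltW c0) ?(ltW C0)//.
by rewrite !ge0_ler_powR ?nnegrE ?invr_ge0 ?mulr_ge0 ?(ltW c0) ?(ltW C0).
Qed.

Lemma exprn_root (x : R) k : 0 <= x -> (0 < k)%N -> (x `^ k%:R^-1) ^+ k = x.
Proof.
move=> x0 k0; rewrite -powR_mulrn ?powR_ge0// -powRrM mulVf ?powRr1//.
by rewrite pnatr_eq0 -lt0n.
Qed.

Lemma root_exprn (x : R) k : 0 <= x -> (0 < k)%N -> (x ^+ k) `^ k%:R^-1 = x.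
Proof.
move=> x0 k0; rewrite -powR_mulrn// -powRrM mulfV ?powRr1//.
by rewrite pnatr_eq0 -lt0n.
Qed.

Lemma powR_sqr (x y : R) : 0 <= x -> (x ^+ 2) `^ y = (x `^ y) ^+ 2.
Proof. by move=> x0; rewrite -!powR_mulrn ?powR_ge0// powRAC. Qed.

(** Fekete's lemma in multiplicative form: the limit is the infimum of the roots
    with positive index. If [u K.+1 <= q ^+ K.+1], Euclidean division of [k] by
    [K.+1] gives [u k <= C * q ^+ k] with [C] independent of [k]. *)
Lemma submul_root_cvg (u : nat -> R) : (forall k, 0 <= u k) ->
  (forall k l, u (k + l)%N <= u k * u l) ->
  exists2 r : R, 0 <= r & u k `^ k%:R^-1 @[k --> \oo] --> r.
Proof.
move=> u0 uM.
pose E := range (fun k => u k.+1 `^ k.+1%:R^-1).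
have E_lb : has_lbound E by exists 0 => _ [k _ <-]; exact: powR_ge0.
have E_neq0 : (E !=set0)%classic by exists (u 1%N `^ 1%:R^-1); exists 0%N.
have r0 : 0 <= inf E.
  by apply: lb_le_inf => // _ [k _ <-]; exact: powR_ge0.
exists (inf E) => //; apply/cvgrPdist_le => e e0.
have e20 : 0 < e / 2 by rewrite divr_gt0.
have [_ [K _ <-] uK] := inf_adherent e20 (conj E_neq0 E_lb).
set q := inf E + e / 2 in uK.
have q0 : 0 < q by apply: ltr_wpDl.
have uKq : u K.+1 <= q ^+ K.+1.
  rewrite -[leLHS](@exprn_root _ K.+1)//.
  by apply: lerXn2r; rewrite ?nnegrE ?powR_ge0 ?(ltW q0) ?(ltW uK).
(* [C] dominates [u b / q ^+ b] for each possible remainder [b]. *)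
pose C := 1 + \sum_(b < K.+1) u b / q ^+ b.
have C0 : 0 < C.
  rewrite ltr_wpDr ?sumr_ge0// => b _.
  by rewrite divr_ge0 ?exprn_ge0 ?(ltW q0).
have uC k : u k <= C * q ^+ k.
  have iter a b : u (a * K.+1 + b)%N <= u K.+1 ^+ a * u b.
    elim: a => [|a IH]; first by rewrite mul0n add0n expr0 mul1r.
    rewrite mulSn -addnA exprS -mulrA (le_trans (uM _ _))//.
    by rewrite ler_wpM2l.
  rewrite [in u k](divn_eq k K.+1) (le_trans (iter _ _))//.
  rewrite [X in q ^+ X](divn_eq k K.+1) exprD mulrCA mulnC exprM.
  apply: ler_pM; rewrite ?exprn_ge0//.
    by apply: lerXn2r; rewrite ?nnegrE ?exprn_ge0 ?(ltW q0).
  rewrite -ler_pdivrMr ?exprn_gt0//.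
  rewrite ler_wpDl// (bigD1 (Ordinal (ltn_pmod k (ltn0Sn K))))//=.
  by rewrite lerDl sumr_ge0// => b _; rewrite divr_ge0 ?exprn_ge0 ?(ltW q0).
have Cq : C `^ k%:R^-1 * q @[k --> \oo] --> q.
  rewrite -[q in X in _ --> X]mul1r.
  by apply: cvgM; [exact: cvg_root_cst|exact: cvg_cst].
move/cvgrPdist_le : Cq => /(_ _ e20) Cqe; near=> k.
have k0 : (0 < k)%N by near: k; exact: nbhs_infty_gt.
have lower : inf E <= u k `^ k%:R^-1.
  by apply: ge_inf => //; exists k.-1 => //; rewrite prednK.
have upper : u k `^ k%:R^-1 <= C `^ k%:R^-1 * q.
  rewrite -[q in leRHS](@root_exprn q k) ?(ltW q0)//.
  rewrite -powRM ?exprn_ge0 ?(ltW q0) ?(ltW C0)//.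
  rewrite ge0_ler_powR ?nnegrE ?invr_ge0//.
  by rewrite mulr_ge0 ?exprn_ge0 ?(ltW q0) ?(ltW C0).
have : `|q - C `^ k%:R^-1 * q| <= e / 2.
  by near: k; exact: Cqe.
rewrite !ler_norml => /andP[+ _]; rewrite /q in upper *.
by move=> h; apply/andP; split; lra.
Unshelve. all: by end_near. Qed.

(** The limit superior is here the limit of the suprema of the tails; the bounds
    on the two sequences make these limits exist. *)
Lemma le_limn_sup (u v : nat -> R) :
  has_lbound (range u) -> has_ubound (range v) ->
  (forall k, u k <= v k) -> limn_sup u <= limn_sup v.
Proof.
move=> lu uv le_uv.
have uu : has_ubound (range u).
  case: uv => M Mv; exists M => _ [k _ <-].
  by rewrite (le_trans (le_uv k))// Mv//; exists k.
have lv : has_lbound (range v).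
  case: lu => M Mu; exists M => _ [k _ <-].
  by rewrite (le_trans _ (le_uv k))// Mu//; exists k.
apply: ler_lim.
- by apply/cvg_ex; exists (inf (range (sups u))); exact: cvg_sups_inf.
- by apply/cvg_ex; exists (inf (range (sups v))); exact: cvg_sups_inf.
- apply: nearW => k; apply: ge_sup; first by exists (u k), k => /=.
  move=> _ [l /= kl <-]; rewrite (le_trans (le_uv l))//.
  by apply: ub_le_sup; [exact: has_ubound_sdrop|exists l].
Qed.

Lemma limn_sup_le (u v : nat -> R) l : has_lbound (range u) ->
  (forall k, u k <= v k) -> v @ \oo --> l -> limn_sup u <= l.
Proof.
move=> lu uv vl; rewrite -(cvg_limn_inf_sup vl).2; apply: le_limn_sup => //.
by apply/bounded_fun_has_ubound/cvg_seq_bounded/cvg_ex; exists l.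
Qed.

Lemma limn_sup_ge (u v : nat -> R) l : has_ubound (range u) ->
  (forall k, v k <= u k) -> v @ \oo --> l -> l <= limn_sup u.
Proof.
move=> lu uv vl; rewrite -(cvg_limn_inf_sup vl).2; apply: le_limn_sup => //.
by apply/bounded_fun_has_lbound/cvg_seq_bounded/cvg_ex; exists l.
Qed.

End roots.

(** * Sums over words *)

Section words.
Variable T : finType.

Lemma big_tuple0 (V : nmodType) (F : seq T -> V) :
  \sum_(t : 0.-tuple T) F t = F [::].
Proof.
rewrite (big_pred1 [tuple]) // => t.
by apply/esym/eqP; exact: tuple0.
Qed.

Lemma big_tuple_cons (V : nmodType) (F : seq T -> V) k :
  \sum_(t : k.+1.-tuple T) F t = \sum_x \sum_(t : k.-tuple T) F (x :: t).
Proof.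
rewrite pair_big.
rewrite (reindex (fun p : T * k.-tuple T => [tuple of p.1 :: p.2]))//.
exists (fun t => (thead t, [tuple of behead t])) => [[x t] _|t _] /=.
  by rewrite theadE; congr pair; apply: val_inj.
by rewrite -tuple_eta.
Qed.

Lemma big_tuple_cat (V : nmodType) k l (F : seq T -> V) :
  \sum_(t : (k + l).-tuple T) F t =
  \sum_(s : k.-tuple T) \sum_(t : l.-tuple T) F (s ++ t).
Proof.
elim: k F => [|k IH] F.
  by rewrite (big_tuple0 (fun s => \sum_(t : l.-tuple T) F (s ++ t))).
rewrite big_tuple_cons.
rewrite (big_tuple_cons (fun s => \sum_(t : l.-tuple T) F (s ++ t))).
by apply: eq_bigr => x _; rewrite (IH (fun s => F (x :: s))).
Qed.

End words.

(** * The squared Frobenius norm *)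

Section frob.
Variable R : realType.

(** The square of the Frobenius norm. *)
Definition frob2 m n (X : 'M[R]_(m, n)) := \sum_i \sum_j X i j ^+ 2.

Lemma frob2_ge0 m n (X : 'M[R]_(m, n)) : 0 <= frob2 X.
Proof. by do 2!(apply: sumr_ge0 => ? _); exact: sqr_ge0. Qed.

Lemma mxtrace_mul_tr m n (X : 'M[R]_(m, n)) : \tr (X *m X^T) = frob2 X.
Proof.
by apply: eq_bigr => i _; rewrite mxE; apply: eq_bigr => j _; rewrite mxE.
Qed.

(** By Lagrange's identity, twice the difference of the two sides is the sum of
    the squares [(a i * b j - a j * b i) ^+ 2]. *)
Lemma sum_cauchy_schwarz (I : finType) (a b : I -> R) :
  (\sum_i a i * b i) ^+ 2 <= (\sum_i a i ^+ 2) * \sum_i b i ^+ 2.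
Proof.
have : 0 <= \sum_i \sum_j (a i * b j - a j * b i) ^+ 2.
  by do 2!(apply: sumr_ge0 => ? _); exact: sqr_ge0.
have -> : \sum_i \sum_j (a i * b j - a j * b i) ^+ 2 =
    \sum_i \sum_j a i ^+ 2 * b j ^+ 2 + \sum_i \sum_j b i ^+ 2 * a j ^+ 2
    - 2 * \sum_i \sum_j (a i * b i) * (a j * b j).
  rewrite mulr_sumr -sumrN -!big_split; apply: eq_bigr => i _ /=.
  rewrite mulr_sumr -sumrN -!big_split; apply: eq_bigr => j _ /=; ring.
by rewrite -!big_distrlr /=; lra.
Qed.

Lemma frob2_mulmx m n p (X : 'M[R]_(m, n)) (Y : 'M[R]_(n, p)) :
  frob2 (X *m Y) <= frob2 X * frob2 Y.
Proof.
rewrite /frob2 mulr_suml; apply: ler_sum => i _.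
rewrite [X in _ * X]exchange_big mulr_sumr /=; apply: ler_sum => j _.
by rewrite mxE; exact: sum_cauchy_schwarz.
Qed.

Lemma norm_sqr_le_frob2 m n (X : 'M[R]_(m, n)) : `|X| ^+ 2 <= frob2 X.
Proof.
rewrite -[leRHS]sqr_sqrtr ?frob2_ge0// ler_sqr ?nnegrE ?sqrtr_ge0//.
apply: mx_norm_le => [|i j]; first exact: sqrtr_ge0.
rewrite -sqrtr_sqr ler_sqrt ?frob2_ge0// /frob2 (bigD1 i)//= (bigD1 j)//=.
rewrite -addrA lerDl addr_ge0//.
  by apply: sumr_ge0 => ? _; exact: sqr_ge0.
by do 2!(apply: sumr_ge0 => ? _); exact: sqr_ge0.
Qed.

Lemma frob2_le_norm_sqr m n (X : 'M[R]_(m, n)) :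
  frob2 X <= (m * n)%:R * `|X| ^+ 2.
Proof.
rewrite /frob2 mulr_natl mulnC mulrnA -[m in _ *+ m]card_ord -sumr_const.
apply: ler_sum => i _; rewrite -[n in _ *+ n]card_ord -sumr_const.
apply: ler_sum => j _.
by rewrite -[X i j ^+ 2]real_normK ?num_real// ler_sqr ?nnegrE// norm_coord_le.
Qed.

(** Equivalence of norms in squared form, which relates an arbitrary norm to the
    sums of squares produced by the trace. *)
Lemma norm_frob2_equiv m n (N : 'M[R]_(m, n) -> R) : is_norm N ->
  exists C, [/\ 0 < C, forall X, frob2 X <= C * N X ^+ 2
                     & forall X, N X ^+ 2 <= C * frob2 X].
Proof.
move=> hN; have N0 := is_norm_ge0 hN.
have [a a0 Na] := mx_norm_ge hN; have [_ NZ ND] := hN.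
have [b b0 Nb] := seminorm_le NZ ND.
have C1 : 0 <= (m * n)%:R * a ^+ 2 by rewrite mulr_ge0 ?exprn_ge0 ?(ltW a0).
have b20 : 0 < b ^+ 2 by rewrite exprn_gt0.
exists ((m * n)%:R * a ^+ 2 + b ^+ 2); split => [|X|X].
- by rewrite ltr_wpDl.
- rewrite mulrDl ler_wpDr ?mulr_ge0 ?exprn_ge0 ?(ltW b0)//.
  rewrite (le_trans (frob2_le_norm_sqr X))// -mulrA ler_wpM2l//.
  by rewrite -exprMn ler_sqr ?nnegrE ?mulr_ge0 ?(ltW a0).
- rewrite mulrDl ler_wpDl ?mulr_ge0 ?frob2_ge0 ?exprn_ge0 ?(ltW a0)//.
  apply: (@le_trans _ _ (b ^+ 2 * `|X| ^+ 2)).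
    by rewrite -exprMn ler_sqr ?nnegrE ?mulr_ge0 ?(ltW b0).
  by rewrite ler_wpM2l ?norm_sqr_le_frob2 ?(ltW b20).
Qed.

End frob.

(** * Powers of the sum of congruence operators *)

Section congr.
Variables (R : realType) (n : nat).
Local Notation S := (subvs_of (symmx R n)).
Local Notation d := (\dim {:S}).
Variables (e : d.-tuple S) (he : basis_of {:S} e).

Lemma congr_op_mul (X Y : 'M[R]_n) :
  congr_op (X *m Y) = (congr_op X \o congr_op Y)%VF.
Proof.
apply/lfunP => Z; apply: val_inj => /=.
by rewrite comp_lfunE !congr_opE trmx_mul !mulmxA.
Qed.

Lemma congr_op1 : congr_op (1%:M : 'M[R]_n) = \1%VF.
Proof.
apply/lfunP => Z; apply: val_inj => /=.
by rewrite congr_opE lfunE/= trmx1 mul1mx mulmx1.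
Qed.

Lemma congr_mx_mul (X Y : 'M[R]_n) :
  congr_mx e (X *m Y) = congr_mx e X *m congr_mx e Y.
Proof.
by rewrite /congr_mx congr_op_mul (passmx.mxof_comp _ _ he) trmx_mul.
Qed.

Lemma congr_mx1 : congr_mx e (1%:M : 'M[R]_n) = 1%:M.
Proof.
by rewrite /congr_mx congr_op1 passmx.mxof1 ?trmx1// (basis_free he).
Qed.

(** The trace of [L(I)], where [L] is the operator on symmetric matrices whose
    matrix is [M]. The transpose converts the column convention of [congr_mx] to
    the row convention of [passmx]. *)
Definition trace_at1 (M : 'M[R]_d) : R :=
  \tr (vsval (passmx.vecof e (passmx.rVof e (vsproj (symmx R n) 1%:M) *m M^T))).

(** The operator sends [I] to [X *m X^T]. *)
Lemma trace_at1_congr_mx (X : 'M[R]_n) : trace_at1 (congr_mx e X) = frob2 X.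
Proof.
rewrite /trace_at1 trmxK -passmx.rVof_app// passmx.rVofK// congr_opE vsprojK.
  by rewrite mulmx1 mxtrace_mul_tr.
by apply/symmxP; rewrite trmx1.
Qed.

Lemma trace_at1_linear : linear trace_at1.
Proof.
move=> a M M'; rewrite /trace_at1 linearP mulmxDr -scalemxAr.
by rewrite passmx.vecof_linear !linearP.
Qed.
HB.instance Definition _ := GRing.isSemilinear.Build R _ _ _ trace_at1
  (GRing.semilinear_linear trace_at1_linear).

(** The entry [(i, j)] of [congr_mx e X] is the [i]-th coordinate of
    [X *m e_j *m X^T], a fixed linear form of a matrix quadratic in [X]. *)
Lemma norm_congr_mx_le : exists2 C, 0 < C &
  forall X : 'M[R]_n, `|congr_mx e X| <= C * frob2 X.
Proof.
have /fin_all_exists2[C C0 CP] (i : 'I_d) : exists2 C : R, 0 < C &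
    forall X : 'M[R]_n, `|coord e i (vsproj (symmx R n) X)| <= C * `|X|.
  apply: (@seminorm_le R n n (fun X => `|coord e i (vsproj _ X)|)) => [a X|X Y].
    by rewrite !linearZ normrM.
  by rewrite !linearD ler_normD.
pose D := \sum_(i < d) \sum_(j < d) C i * (n%:R ^+ 2 * `|vsval e`_j|).
have D0 : 0 <= D.
  by do 2!(apply: sumr_ge0 => ? _); rewrite !mulr_ge0 ?(ltW (C0 _)).
exists (1 + D) => [|X]; first by rewrite ltr_pwDl.
have X0 := frob2_ge0 X.
apply: mx_norm_le => [|i j]; first by rewrite mulr_ge0// addr_ge0.
have -> : congr_mx e X i j =
    coord e i (vsproj (symmx R n) (X *m vsval e`_j *m X^T)).
  rewrite -congr_opE vsvalK congr_mxE// linear_sum/= (bigD1 i)//= linearZ/=.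
  rewrite coord_free ?(basis_free he)// eqxx mulr1 big1 ?addr0// => k ki.
  by rewrite linearZ/= coord_free ?(basis_free he)// (negbTE ki) mulr0.
apply: (le_trans (CP _ _)).
apply: (@le_trans _ _ (C i * (n%:R ^+ 2 * `|vsval e`_j|) * frob2 X)).
  rewrite -mulrA ler_wpM2l ?(ltW (C0 i))//.
  rewrite (le_trans (norm_mulmx_le _ _))// norm_trmx.
  apply: (@le_trans _ _ (n%:R * (n%:R * (`|X| * `|vsval e`_j|) * `|X|))).
    by rewrite !ler_wpM2l// ler_wpM2r// norm_mulmx_le.
  rewrite [leLHS](_ : _ = n%:R ^+ 2 * `|vsval e`_j| * `|X| ^+ 2); last by ring.
  by rewrite ler_wpM2l ?norm_sqr_le_frob2// mulr_ge0.
rewrite ler_wpM2r// ler_wpDl// /D (bigD1 i)//= (bigD1 j)//= -addrA lerDl.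
rewrite addr_ge0 ?sumr_ge0// => k _.
  by rewrite !mulr_ge0 ?(ltW (C0 _)).
rewrite ?sumr_ge0 ?mulr_ge0 ?(ltW (C0 _))//.
by move=> l _; rewrite !mulr_ge0 ?(ltW (C0 _)).
Qed.

Variables (m : nat) (A : 'I_m -> 'M[R]_n).

Lemma word_prod_cat s t : word_prod A (s ++ t) = word_prod A t *m word_prod A s.
Proof. by rewrite /word_prod rev_cat big_cat. Qed.

Lemma word_prod1 i : word_prod A [:: i] = A i.
Proof. exact: big_seq1. Qed.

(** Expanding the noncommutative power produces each word once, since
    [congr_mx e] is multiplicative. *)
Lemma congr_mx_sum_exp k : (\sum_i congr_mx e (A i)) ^+ k =
  \sum_(s : k.-tuple 'I_m) congr_mx e (word_prod A s).
Proof.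
elim: k => [|k IH].
  rewrite (big_tuple0 (fun s => congr_mx e (word_prod A s))) expr0.
  by rewrite /word_prod big_nil congr_mx1.
rewrite (big_tuple_cons (fun s => congr_mx e (word_prod A s))) exprSr IH.
rewrite mulr_sumr; apply: eq_bigr => i _; rewrite mulr_suml.
apply: eq_bigr => s _; rewrite -cat1s word_prod_cat congr_mx_mul.
by rewrite word_prod1.
Qed.

Definition frob2_sum k := \sum_(s : k.-tuple 'I_m) frob2 (word_prod A s).

Lemma frob2_sum_ge0 k : 0 <= frob2_sum k.
Proof. by apply: sumr_ge0 => s _; exact: frob2_ge0. Qed.

(** A word of length [k + l] is a word of length [k] followed by one of length
    [l], and the Frobenius norm is submultiplicative. *)
Lemma frob2_sum_submul k l : frob2_sum (k + l) <= frob2_sum k * frob2_sum l.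
Proof.
rewrite /frob2_sum (big_tuple_cat k l (fun s => frob2 (word_prod A s))).
rewrite mulr_suml; apply: ler_sum => s _.
rewrite mulr_sumr; apply: ler_sum => t _.
by rewrite word_prod_cat mulrC frob2_mulmx.
Qed.

(** The lower bound holds because the linear form [trace_at1] takes the value
    [frob2_sum k] at the [k]-th power; the upper bound sums [norm_congr_mx_le]
    over the words. Positivity of [X |-> A *m X *m A^T] thus enters only through
    the absence of cancellation in the trace. *)
Lemma norm_congr_mx_sum_exp_equiv (N : 'M[R]_d -> R) : is_norm N ->
  exists c C, [/\ 0 < c, 0 < C & forall k,
    c * frob2_sum k <= N ((\sum_i congr_mx e (A i)) ^+ k) <= C * frob2_sum k].
Proof.
move=> hN; have [_ NZ ND] := hN.
have [a a0 Na] := mx_norm_ge hN.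
have [b b0 Nb] := seminorm_le NZ ND.
have [C C0 CP] := norm_congr_mx_le.
have [||t t0 tP] := @seminorm_le R d d (fun M => `|trace_at1 M|).
- by move=> x M; rewrite linearZ normrM.
- by move=> M M'; rewrite linearD ler_normD.
exists (t * a)^-1, (b * C); rewrite invr_gt0 !mulr_gt0//; split=> // k.
rewrite congr_mx_sum_exp; apply/andP; split.
  rewrite ler_pdivrMl ?mulr_gt0//.
  have -> : frob2_sum k =
      trace_at1 (\sum_(s : k.-tuple 'I_m) congr_mx e (word_prod A s)).
    by rewrite linear_sum; apply: eq_bigr => s _; rewrite /= trace_at1_congr_mx.
  rewrite (le_trans (ler_norm _))// (le_trans (tP _))// -mulrA.
  by rewrite ler_wpM2l ?(ltW t0).
rewrite (le_trans (Nb _))// -mulrA ler_wpM2l ?(ltW b0)//.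
rewrite (le_trans (ler_norm_sum _ _ _))// mulr_sumr.
by apply: ler_sum => s _.
Qed.

End congr.

(** * Comparison with the largest product *)

Section bounds.
Variables (R : realType) (m n : nat) (A : 'I_m -> 'M[R]_n) (N : 'M[R]_n -> R).
Hypothesis hN : is_norm N.

Definition max_root k : R :=
  \big[Num.max/0]_(s : k.-tuple 'I_m) N (word_prod A s) `^ k%:R^-1.

(** One term of a sum of nonnegative terms is at most the sum. *)
Lemma max_root_le_frob2_sum C : 0 < C -> (forall X, N X ^+ 2 <= C * frob2 X) ->
  forall k, max_root k <= Num.sqrt ((C * frob2_sum A k) `^ k%:R^-1).
Proof.
move=> C0 NC k; apply/bigmax_leP; split=> [|s _]; first exact: sqrtr_ge0.
have N0 := is_norm_ge0 hN (word_prod A s).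
rewrite -[leLHS]ger0_norm ?powR_ge0// -sqrtr_sqr ler_sqrt ?powR_ge0//.
rewrite -powR_sqr// ge0_ler_powR ?nnegrE ?invr_ge0 ?exprn_ge0//.
  by rewrite mulr_ge0 ?frob2_sum_ge0 ?(ltW C0).
rewrite (le_trans (NC _))// ler_wpM2l ?(ltW C0)//.
rewrite /frob2_sum (bigD1 s)//= lerDl sumr_ge0// => t _; exact: frob2_ge0.
Qed.

(** The sum over the [m ^ k] words is at most [m ^ k] times its largest term; the
    [k]-th root of [m ^ k] is the source of the factor [m]. *)
Lemma frob2_sum_le_max_root C : (0 < m)%N ->
  0 < C -> (forall X, frob2 X <= C * N X ^+ 2) ->
  forall k, (Num.sqrt m%:R)^-1 *
    Num.sqrt ((C^-1 * frob2_sum A k) `^ k%:R^-1) <= max_root k.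
Proof.
move=> m0 C0 NC k; have N0 := is_norm_ge0 hN.
have sm : 0 < Num.sqrt (m%:R : R) by rewrite sqrtr_gt0 ltr0n.
pose s0 := [tuple of nseq k (Ordinal m0)].
case: (@Order.TotalTheory.arg_maxP _ _ _ s0 xpredT
         (fun s => N (word_prod A s)) isT) => s _ smax.
apply: (@le_trans _ _ (N (word_prod A s) `^ k%:R^-1)); last first.
  exact: (le_bigmax _ (fun s : k.-tuple 'I_m => N (word_prod A s) `^ k%:R^-1)).
rewrite ler_pdivrMl//.
have -> : N (word_prod A s) `^ k%:R^-1 =
    Num.sqrt ((N (word_prod A s) `^ k%:R^-1) ^+ 2).
  by rewrite sqrtr_sqr ger0_norm ?powR_ge0.
rewrite -sqrtrM ?ler0n// ler_sqrt; last by rewrite mulr_ge0 ?sqr_ge0.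
apply: (@le_trans _ _ (((m ^ k)%:R * N (word_prod A s) ^+ 2) `^ k%:R^-1)).
  have S0 := frob2_sum_ge0 A k; have Ci : 0 <= C^-1 by rewrite invr_ge0 ltW.
  rewrite ge0_ler_powR ?nnegrE ?invr_ge0 ?mulr_ge0 ?exprn_ge0//.
  rewrite ler_pdivrMl// mulrCA mulr_natl.
  rewrite -[m in (m ^ k)%N]card_ord -card_tuple -sumr_const.
  apply: ler_sum => t _; rewrite (le_trans (NC _))// ler_wpM2l ?(ltW C0)//.
  by rewrite ler_sqr ?nnegrE//; exact: smax.
rewrite powRM ?exprn_ge0 ?ler0n// powR_sqr// ler_wpM2r ?sqr_ge0//.
(* For [k = 0] the exponent is 0 and the claim reads [1 <= m]. *)
case: k {s0 s smax} => [|k]; first by rewrite invr0 powRr0 ler1n.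
by rewrite natrX root_exprn.
Qed.

End bounds.

(** * Bounds on the joint spectral radius *)

Theorem theorem5 (R : realType) (m n : nat) (hm : (0 < m)%N) (hn : (0 < n)%N)
  (A : 'I_m -> 'M[R]_n)
  (e : (\dim {:subvs_of (symmx R n)}).-tuple (subvs_of (symmx R n)))
  (he : basis_of {:subvs_of (symmx R n)} e)
  (N : 'M[R]_n -> R) (hN : is_norm N)
  (N' : 'M[R]_(\dim {:subvs_of (symmx R n)}) -> R) (hN' : is_norm N') :
  (Num.sqrt m%:R)^-1 *
    Num.sqrt (spectral_radius N' (\sum_(i < m) congr_mx e (A i)))
    <= joint_spectral_radius N A
  /\ joint_spectral_radius N A
    <= Num.sqrt (spectral_radius N' (\sum_(i < m) congr_mx e (A i))).
Proof.
have [r r0 Sr] := submul_root_cvg (frob2_sum_ge0 A) (frob2_sum_submul A).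
have scaled (c : R) : 0 < c ->
    ((c * frob2_sum A k) `^ k%:R^-1 @[k --> \oo] --> (r : R))%classic.
  move=> c0; apply: (cvg_root_squeeze c0 c0 (frob2_sum_ge0 A)) Sr => k //.
have sqrt_scaled (c : R) : 0 < c ->
    (Num.sqrt ((c * frob2_sum A k) `^ k%:R^-1) @[k --> \oo]
      --> Num.sqrt (r : R))%classic.
  move=> c0; apply: continuous_cvg; first exact: sqrt_continuous.
  exact: scaled.
have -> : spectral_radius N' (\sum_(i < m) congr_mx e (A i)) = r.
  have [c [C [c0 C0 cC]]] := norm_congr_mx_sum_exp_equiv he A hN'.
  apply: cvg_lim => //.
  apply: (cvg_root_squeeze c0 C0 (frob2_sum_ge0 A)) Sr => k;
    by have /andP[] := cC k.
have [C [C0 fN Nf]] := norm_frob2_equiv hN.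
have upper := max_root_le_frob2_sum A hN C0 Nf.
have lower := frob2_sum_le_max_root A hN hm C0 fN.
have Ci0 : 0 < C^-1 by rewrite invr_gt0.
split.
- apply: limn_sup_ge lower _.
    have /cvg_seq_bounded/bounded_fun_has_ubound[M MP] :
        cvgn (fun k => Num.sqrt ((C * frob2_sum A k) `^ k%:R^-1)).
      by apply/cvg_ex; exists (Num.sqrt r); exact: sqrt_scaled.
    exists M => _ [k _ <-]; apply: le_trans (upper k) _.
    by apply: MP; exists k.
  by apply: cvgM; [exact: cvg_cst|exact: sqrt_scaled].
- apply: limn_sup_le upper (sqrt_scaled _ C0).
  exists 0 => _ [k _ <-]; apply: le_trans (lower k).
  by rewrite mulr_ge0 ?invr_ge0 ?sqrtr_ge0.
Qed.
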